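(* For all non-negative integers $n=n_0+3n_1+9n_2+\dots+3^mn_m$ and $k=k_0+3k_1+9k_2+\dots+3^mk_m$, where $0\le n_i,k_i\le 2$ for all $i$, we have $$\begin{aligned} \binom nk\equiv{}& \binom{n_0}{k_0}\binom{n_1}{k_1}\cdots\binom{n_m}{k_m}\\ &+\sum_{\nu=1}^m 3n_\nu\,\chi(n_{\nu-1}=0)\binom{n_0}{k_0}\cdots\binom{n_{\nu-2}}{k_{\nu-2}}\binom{1}{k_{\nu-1}-1}\binom{n_\nu-1}{k_\nu}\binom{n_{\nu+1}}{k_{\nu+1}}\cdots\binom{n_m}{k_m}\\ &+\sum_{\nu=1}^m 3n_\nu\,\chi(n_{\nu-1}=1,\,k_{\nu-1}=0)\binom{n_0}{k_0}\cdots\binom{n_{\nu-2}}{k_{\nu-2}}\binom{n_\nu}{k_\nu}\cdots\binom{n_m}{k_m}\\ &-\sum_{\nu=1}^m 3n_\nu\,\chi(n_{\nu-1}=1)\binom{n_0}{k_0}\cdots\binom{n_{\nu-2}}{k_{\nu-2}}\binom{2}{k_{\nu-1}}\binom{n_\nu-1}{k_\nu}\binom{n_{\nu+1}}{k_{\nu+1}}\cdots\binom{n_m}{k_m}\\ &+\sum_{\nu=1}^m 3n_\nu\,\chi(n_{\nu-1}=2,\,k_{\nu-1}=1)\binom{n_0}{k_0}\cdots\binom{n_{\nu-2}}{k_{\nu-2}}\binom{n_\nu}{k_\nu}\cdots\binom{n_m}{k_m}\pmod 9. \end{aligned}$$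
   Context: Here $\chi(\mathcal S)=1$ if the statement $\mathcal S$ is true and $\chi(\mathcal S)=0$ otherwise. For $a\ge 0$, $\binom ab$ is the usual binomial coefficient, equal to $0$ when $b<0$ or $b>a$; summands with $n_\nu=0$ are $0$ because of the factor $3n_\nu$. In the summands, products such as $\binom{n_0}{k_0}\cdots\binom{n_{\nu-2}}{k_{\nu-2}}$ are empty (equal to $1$) when $\nu=1$, and similarly at the other end when $\nu=m$. *)

(* Defs.v *)
From mathcomp Require Export all_boot all_order all_algebra.

Set Implicit Arguments.
Unset Strict Implicit.
Unset Printing Implicit Defensive.

Local Open Scope ring_scope.

(* 'C(a, b) has a lower argument in nat, where 0 - 1 = 0. Lowering that argument
   by 1 can make it negative, and the coefficient must then vanish, so it is
   allowed to be an int here. *)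
Definition binz (a : nat) (b : int) : nat :=
  if b is Posz j then 'C(a, j) else 0%N.

Definition chi (S : bool) : int := if S then 1 else 0.

(* Main.v *)
Require Import Defs.
From mathcomp Require Import all_boot all_order all_algebra.
From mathcomp Require Import zify ring.
Import Order.TTheory GRing.Theory Num.Theory.
Local Open Scope ring_scope.

(* Modulo 9, (1 + x)^(3N) = (1 + x^3)^N + 3N (x + x^2) (1 + x^3)^(N-1);
   multiplying by (1 + x)^a and comparing coefficients strips the lowest ternary
   digits off the binomial coefficient. The correction carries a factor 3N, so
   N matters there only modulo 3 and Lucas' theorem evaluates the binomial
   coefficients in it; induction on the number of digits concludes. *)

Lemma bin_add3 (n j : nat) :
  'C(n.+3, j.+3) = ('C(n, j.+3) + 3 * 'C(n, j.+2) + 3 * 'C(n, j.+1) + 'C(n, j))%N.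
Proof. rewrite !binS; lia. Qed.

(* The factor M makes Pascal's rule survive M = 0, where M.-1 = 0. *)
Lemma bin_pred_pascal (M J : nat) :
  M%:Z * 'C(M, J.+1)%:Z = M%:Z * ('C(M.-1, J.+1)%:Z + 'C(M.-1, J)%:Z).
Proof. by case: M => [|M]; rewrite ?mul0r //= binS PoszD. Qed.

(** Induction on [N], multiplying by (1 + x)^3 = 1 + 3x + 3x^2 + x^3. The coefficients at exponents
    not divisible by 3 are multiples of 3, so the middle terms 3x and 3x^2 turn them into multiples
    of 9. *)
Lemma bin_mul3 (N K : nat) :
  [/\ exists t : int, 'C(3 * N, 3 * K)%:Z = 'C(N, K)%:Z + 9 * t,
      exists t : int, 'C(3 * N, (3 * K).+1)%:Z = 3 * N%:Z * 'C(N.-1, K)%:Z + 9 * t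
    & exists t : int, 'C(3 * N, (3 * K).+2)%:Z = 3 * N%:Z * 'C(N.-1, K)%:Z + 9 * t].
Proof.
elim: N K => [|N IH] K.
  rewrite muln0 /= mulr0 !mul0r !bin0n; case: K => [|K];
    by rewrite ?mulnS; split; exists 0; rewrite ?mulr0 ?addr0.
rewrite mulnS add3n [N.+1.-1]/=.
case: K => [|K].
  have [_ _ [t2 E2]] := IH 0%N.
  rewrite !muln0 !bin0 !mulr1 in E2 *.
  split; first by exists 0.
    by exists 0; rewrite bin1; lia.
  by exists (t2 + N%:Z); rewrite !binS !bin0 bin1; lia.
have [[u0 F0] [u1 F1] [u2 F2]] := IH K.
have [[t0 E0] [t1 E1] [t2 E2]] := IH K.+1.
rewrite !mulnS !add3n in E0 E1 E2 *.
have Pc := bin_pred_pascal N K.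
rewrite !bin_add3 binS; split.
- exists (t0 + u0 + N%:Z * 'C(N.-1, K)%:Z *+ 2 + 3 * u1 + 3 * u2).
  lia.
- exists (t1 + u1 + 3 * t0 + 3 * u2 + N%:Z * 'C(N.-1, K)%:Z).
  lia.
- exists (t2 + u2 + 3 * t0 + 3 * t1 + N%:Z * 'C(N.-1, K.+1)%:Z).
  lia.
Qed.

(* The correction for lowest digits a, b; x and y stand for 'C(N.-1, K) and
   'C(N, K) modulo 3. *)
Definition digit_corr (a b : nat) (x y : int) : int :=
  chi (a == 0%N) * (binz 1 (b%:Z - 1))%:Z * x
  + chi ((a == 1%N) && (b == 0%N)) * y
  - chi (a == 1%N) * 'C(2, b)%:Z * x
  + chi ((a == 2%N) && (b == 1%N)) * y.

(** By linearity in [x] and [y]; under the factor 3N, only their residues modulo 3 then count modulo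
    9. *)
Lemma digit_corrD3 (a b : nat) (x y t u : int) :
  digit_corr a b (x + 3 * t) (y + 3 * u)
    = digit_corr a b x y + 3 * digit_corr a b t u.
Proof. by rewrite /digit_corr; ring. Qed.

Lemma bin_digit_mod9 (N K a b : nat) : (a <= 2)%N -> (b <= 2)%N ->
  exists t : int, 'C(3 * N + a, 3 * K + b)%:Z
    = 'C(a, b)%:Z * 'C(N, K)%:Z + 3 * N%:Z * digit_corr a b 'C(N.-1, K) 'C(N, K) + 9 * t.
Proof.
move=> a2 b2.
(* As a divisibility, the claim needs no explicit witness in each of the nine digit pairs. *)
suff /dvdzP[t E] : (9 %| 'C(3 * N + a, 3 * K + b)%:Z
    - ('C(a, b)%:Z * 'C(N, K)%:Z + 3 * N%:Z * digit_corr a b 'C(N.-1, K) 'C(N, K)))%Z.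
  by exists t; lia.
have small : ('C(0, 2) = 0)%N * ('C(1, 1 - 1) = 1)%N * ('C(1, 2 - 1) = 1)%N by [].
(* For [b < a], Pascal's rule reaches down to the exponents 3K - 1 and 3K - 2, which are absent when
   [K = 0]. *)
case: K => [|K].
  have [_ _ [t2 E2]] := bin_mul3 N 0%N.
  rewrite /digit_corr muln0 add0n !bin0 mulr1 in E2 *.
  case: a a2 => [|[|[|//]]] _; case: b b2 => [|[|[|//]]] _;
    rewrite ?addn0 ?addn1 ?addn2 ?(binS, bin0, bin1) /chi /= ?small; lia.
have [[u0 F0] [u1 F1] [u2 F2]] := bin_mul3 N K.
have [[t0 E0] [t1 E1] [t2 E2]] := bin_mul3 N K.+1.
(* This rewrites the lower neighbour as N C(N-1, K) = N (C(N, K+1) - C(N-1, K+1)), the source of the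
   [y] terms and of the minus sign in [digit_corr]. *)
have Pc := bin_pred_pascal N K.
rewrite /digit_corr mulnS !add3n in E0 E1 E2 *.
case: a a2 => [|[|[|//]]] _; case: b b2 => [|[|[|//]]] _;
  rewrite ?addn0 ?addn1 ?addn2 ?binS /chi /= ?small ?(bin0, bin1); lia.
Qed.

Definition base3 (m : nat) (d : nat -> nat) : nat :=
  (\sum_(0 <= i < m.+1) 3 ^ i * d i)%N.

Lemma base3_0 (d : nat -> nat) : base3 0 d = d 0%N.
Proof. by rewrite /base3 big_nat1 mul1n. Qed.

Lemma base3S (m : nat) (d : nat -> nat) :
  base3 m.+1 d = (3 * base3 m (fun i => d i.+1) + d 0)%N.
Proof.
rewrite /base3 big_nat_recl // expn0 mul1n addnC big_distrr /=; congr addn.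
by apply: eq_bigr => i _; rewrite expnS mulnA.
Qed.

Lemma base3_mod3 (m : nat) (d : nat -> nat) :
  exists q, base3 m d = (3 * q + d 0)%N.
Proof.
case: m => [|m]; first by exists 0%N; rewrite base3_0.
by rewrite base3S; eexists.
Qed.

(** Lucas' theorem for the prime 3: modulo 3 the correction in [bin_digit_mod9] disappears. *)
Lemma lucas3 (m : nat) (dn dk : nat -> nat) :
  (forall i, (i <= m)%N -> (dn i <= 2)%N) ->
  (forall i, (i <= m)%N -> (dk i <= 2)%N) ->
  exists t : int, 'C(base3 m dn, base3 m dk)%:Z
    = \prod_(0 <= i < m.+1) 'C(dn i, dk i)%:Z + 3 * t.
Proof.
elim: m dn dk => [|m IH] dn dk hn hk.
  by exists 0; rewrite !base3_0 big_nat1 mulr0 addr0.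
have [t E] := IH _ _ (fun i => hn i.+1) (fun i => hk i.+1).
rewrite !base3S big_nat_recl //.
have [s ->] := bin_digit_mod9 (base3 m (fun i => dn i.+1))
  (base3 m (fun i => dk i.+1)) _ _ (hn 0%N isT) (hk 0%N isT).
rewrite E; set N := base3 _ _; set D := digit_corr _ _ _ _.
exists ('C(dn 0%N, dk 0%N)%:Z * t + N%:Z * D + 3 * s); ring.
Qed.

(** With a positive lowest digit, subtracting 1 causes no borrow: only that digit changes, and
    [lucas3] applies to the new digits. *)
Lemma lucas3_pred (m : nat) (dn dk : nat -> nat) : (0 < dn 0)%N ->
  (forall i, (i <= m)%N -> (dn i <= 2)%N) ->
  (forall i, (i <= m)%N -> (dk i <= 2)%N) ->
  exists t : int, 'C((base3 m dn).-1, base3 m dk)%:Z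
    = 'C((dn 0).-1, dk 0)%:Z * \prod_(1 <= i < m.+1) 'C(dn i, dk i)%:Z + 3 * t.
Proof.
move=> n0 hn hk; pose d i := if i is 0 then (dn 0%N).-1 else dn i.
have hd i : (i <= m)%N -> (d i <= 2)%N.
  by case: i => [|i] /hn //=; lia.
have [t E] := lucas3 _ _ _ hd hk; exists t.
have -> : (base3 m dn).-1 = base3 m d.
  by case: (m) => [|p]; rewrite ?base3_0 ?base3S //= -subn1 -addnBA // subn1.
rewrite E big_nat_recl // big_add1 /=; congr (_ + _).
Qed.

(* The terms nu = j.+1 of the four sums together. *)
Definition bin_corr (m : nat) (dn dk : nat -> nat) (j : nat) : int :=
  3 * (dn j.+1)%:Z * \prod_(0 <= i < j) 'C(dn i, dk i)%:Z
  * digit_corr (dn j) (dk j)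
      ('C((dn j.+1).-1, dk j.+1)%:Z
       * \prod_(j.+2 <= i < m.+1) 'C(dn i, dk i)%:Z)
      (\prod_(j.+1 <= i < m.+1) 'C(dn i, dk i)%:Z).

Lemma bin_corr0 (m : nat) (dn dk : nat -> nat) :
  bin_corr m.+1 dn dk 0 = 3 * (dn 1%N)%:Z * digit_corr (dn 0%N) (dk 0%N)
    ('C((dn 1%N).-1, dk 1%N)%:Z * \prod_(1 <= i < m.+1) 'C(dn i.+1, dk i.+1)%:Z)
    (\prod_(0 <= i < m.+1) 'C(dn i.+1, dk i.+1)%:Z).
Proof. by rewrite /bin_corr big_geq // mulr1 !(big_add1 _ _ _ m.+2). Qed.

Lemma bin_corrS (m : nat) (dn dk : nat -> nat) (j : nat) :
  bin_corr m.+1 dn dk j.+1 = 'C(dn 0%N, dk 0%N)%:Z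
    * bin_corr m (fun i => dn i.+1) (fun i => dk i.+1) j.
Proof. by rewrite /bin_corr big_nat_recl // !(big_add1 _ _ _ m.+2) /=; ring. Qed.

Lemma bin_base3_mod9 (m : nat) (dn dk : nat -> nat) :
  (forall i, (i <= m)%N -> (dn i <= 2)%N) ->
  (forall i, (i <= m)%N -> (dk i <= 2)%N) ->
  exists t : int, 'C(base3 m dn, base3 m dk)%:Z
    = \prod_(0 <= i < m.+1) 'C(dn i, dk i)%:Z
      + \sum_(0 <= j < m) bin_corr m dn dk j + 9 * t.
Proof.
elim: m dn dk => [|m IH] dn dk hn hk.
  by exists 0; rewrite !base3_0 big_nat1 big_geq // mulr0 !addr0.
pose dn' i := dn i.+1; pose dk' i := dk i.+1.
have hn' i : (i <= m)%N -> (dn' i <= 2)%N by exact: (hn i.+1).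
have hk' i : (i <= m)%N -> (dk' i <= 2)%N by exact: (hk i.+1).
have [t E] := IH _ _ hn' hk'.
have [u Y] := lucas3 _ _ _ hn' hk'.
have [q Q] := base3_mod3 m dn'.
have [s S] := bin_digit_mod9 (base3 m dn') (base3 m dk') _ _ (hn 0%N isT) (hk 0%N isT).
rewrite !base3S S {S} big_nat_recl // [\sum_(0 <= j < m.+1) _]big_nat_recl //.
rewrite (eq_bigr _ (fun j _ => bin_corrS m dn dk j)) -mulr_sumr bin_corr0.
rewrite -/dn' -/dk' -/(dn' 0%N) -/(dk' 0%N).
set P := \prod_(0 <= i < m.+1) _ in E Y *; set Sg := \sum_(0 <= j < m) _ in E *.
set B := 'C(dn 0%N, dk 0%N)%:Z.
(* If the next digit is 0, then N = 3q and the correction 3N D is a multiple of 9, matching the zero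
   term [j = 0]; no predecessor has to be evaluated. *)
have [n0|n_gt0] := posnP (dn' 0%N).
  rewrite E {}Q n0 addn0; set D := digit_corr _ _ _ _.
  exists (B * t + q%:Z * D + s); rewrite PoszM; ring.
have [v X] := lucas3_pred _ _ _ n_gt0 hn' hk'.
(* The occurrence of C(N, K) inside [digit_corr] is needed only modulo 3 and uses [Y]; the leading
   one is needed modulo 9 and uses [E]. *)
rewrite X {2}Y digit_corrD3 E {}Q.
set D := digit_corr _ _ _ _; set D' := digit_corr _ _ _ _.
exists (B * t + s + q%:Z * D + (3 * q%:Z + (dn' 0%N)%:Z) * D').
rewrite PoszD PoszM; ring.
Qed.

Theorem lemma1 (m n k : nat) (dn dk : nat -> nat)
    (Hdn : forall i : nat, (i <= m)%N -> (dn i <= 2)%N)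
    (Hdk : forall i : nat, (i <= m)%N -> (dk i <= 2)%N)
    (Hn : n = (\sum_(0 <= i < m.+1) 3 ^ i * dn i)%N)
    (Hk : k = (\sum_(0 <= i < m.+1) 3 ^ i * dk i)%N) :
  ('C(n, k)%:Z =
     \prod_(0 <= i < m.+1) 'C(dn i, dk i)%:Z
     + \sum_(1 <= nu < m.+1)
         3 * (dn nu)%:Z * chi (dn nu.-1 == 0%N)
         * \prod_(0 <= i < nu.-1) 'C(dn i, dk i)%:Z
         * (binz 1 ((dk nu.-1)%:Z - 1))%:Z
         * 'C((dn nu).-1, dk nu)%:Z
         * \prod_(nu.+1 <= i < m.+1) 'C(dn i, dk i)%:Z
     + \sum_(1 <= nu < m.+1)
         3 * (dn nu)%:Z * chi ((dn nu.-1 == 1%N) && (dk nu.-1 == 0%N))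
         * \prod_(0 <= i < nu.-1) 'C(dn i, dk i)%:Z
         * \prod_(nu <= i < m.+1) 'C(dn i, dk i)%:Z
     - \sum_(1 <= nu < m.+1)
         3 * (dn nu)%:Z * chi (dn nu.-1 == 1%N)
         * \prod_(0 <= i < nu.-1) 'C(dn i, dk i)%:Z
         * 'C(2, dk nu.-1)%:Z
         * 'C((dn nu).-1, dk nu)%:Z
         * \prod_(nu.+1 <= i < m.+1) 'C(dn i, dk i)%:Z
     + \sum_(1 <= nu < m.+1)
         3 * (dn nu)%:Z * chi ((dn nu.-1 == 2%N) && (dk nu.-1 == 1%N))
         * \prod_(0 <= i < nu.-1) 'C(dn i, dk i)%:Z
         * \prod_(nu <= i < m.+1) 'C(dn i, dk i)%:Z
   %[mod 9])%Z.
Proof.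
have [t E] := bin_base3_mod9 m dn dk Hdn Hdk.
rewrite -/(base3 m dn) in Hn; rewrite -/(base3 m dk) in Hk.
apply/eqP; rewrite eqz_mod_dvd {}Hn {}Hk {}E; apply/dvdzP; exists t.
(* Shifting by nu = j + 1 gives the four sums the index range of [bin_corr], whose expansion then
   matches them term by term. *)
rewrite !big_add1 /=; set S1 := \sum_(0 <= i < m) _ * 'C(_, _)%:Z * _.
set S2 := (X in _ - (_ + X - _ + _)); set S3 := (X in _ - (_ - X + _)).
set S4 := (X in _ - (_ - _ + X)).
have -> : \sum_(0 <= j < m) bin_corr m dn dk j = S1 + S2 - S3 + S4.
  rewrite -big_split -sumrB -big_split /=; apply: eq_bigr => j _.
  by rewrite /bin_corr /digit_corr; ring.
ring.
Qed.
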